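(* Let $K\subset\mathbb R^n$ be a full-dimensional compact convex body and let $G\subseteq\mathbb R^n$ be a dense set. Suppose that for every $v\in G$ there exist a point $p_v\in K$, an affine hyperplane $H_v$ not containing $p_v$, and a compact convex set $B_v\subseteq H_v$ such that \[ K=\operatorname{conv}(\{p_v\}\cup B_v)\qquad\text{and}\qquad\langle v,p_v\rangle=\min_{y\in K}\langle v,y\rangle. \] Then $K$ is an $n$-dimensional simplex.
   Context: A convex body is a compact convex subset of $\mathbb R^n$; it is full-dimensional if its interior is nonempty. $\langle\cdot,\cdot\rangle$ is the standard Euclidean pairing. *)

(* Defs.v *)
From HB Require Import structures.
From mathcomp Require Import all_boot all_order all_algebra.
From mathcomp Require Import all_classical all_reals all_analysis.

Set Implicit Arguments.
Unset Strict Implicit.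
Unset Printing Implicit Defensive.

Import Order.TTheory GRing.Theory Num.Theory.
Import numFieldNormedType.Exports.

Local Open Scope classical_set_scope.
Local Open Scope ring_scope.

Definition dot (R : realType) (n : nat) (u v : 'rV[R]_n) : R :=
  \sum_(i < n) u ord0 i * v ord0 i.

Definition convex_body (R : realType) (n : nat) (K : set 'rV[R]_n) : Prop :=
  compact K /\ convex_set K.

Definition full_dimensional (R : realType) (n : nat) (K : set 'rV[R]_n) : Prop :=
  interior K !=set0.

Definition conv_hull (R : realType) (n : nat) (A : set 'rV[R]_n) : set 'rV[R]_n :=
  smallest (fun C : set 'rV[R]_n => convex_set C) A.

Definition affine_hyperplane (R : realType) (n : nat) (H : set 'rV[R]_n) : Prop :=
  exists (a : 'rV[R]_n) (b : R), a != 0 /\ H = [set x | dot a x = b].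

(* The k vectors x_1 - x_0, ..., x_k - x_0 are linearly independent. *)
Definition affinely_independent (R : realType) (n k : nat)
    (x : 'I_k.+1 -> 'rV[R]_n) : Prop :=
  row_free (\matrix_(i < k) (x (lift ord0 i) - x ord0)).

Definition is_simplex (R : realType) (n k : nat) (K : set 'rV[R]_n) : Prop :=
  exists x : 'I_k.+1 -> 'rV[R]_n,
    affinely_independent x /\ K = conv_hull (range x).

(* Main.v *)
Require Import Defs.
From HB Require Import structures.
From mathcomp Require Import all_boot all_order all_algebra.
From mathcomp Require Import all_classical all_reals all_analysis.
From mathcomp Require Import ring lra.
Import Order.TTheory GRing.Theory Num.Theory.
Import numFieldNormedType.Exports.
Local Open Scope classical_set_scope.
Local Open Scope ring_scope.

(** Call a point p of K an apex if K is a cone with vertex p over a base lying in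
    a hyperplane that misses p.  Rescaling the equation of the hyperplane gives
    an affine function, the height, equal to 1 at p and to 0 on the base.  On K
    the height lies in [0, 1], and p is the only point of height 1; so p is an
    exposed, hence extreme, point.  An extreme point q of the cone other than p
    must lie in the base, so the height of p vanishes at every other apex
    ([apex_height_eq0]).  Distinct apexes therefore come with a dual system of
    affine functions, f_i (x_j) = 1 if i = j and 0 otherwise, which makes them
    affinely independent ([dual_edge_mulmx]).

    Density supplies n + 1 apexes.  Suppose that x_0, ..., x_k are apexes and
    k < n.  Some nonzero linear form is constant on the x_i, and since K has
    interior points, this form or its opposite is smaller at some y in K than at
    all the x_i ([separating_direction]).  Finitely many strict inequalities
    survive a small perturbation of the form, so they also hold for a v in G; the
    apex that minimizes v over K is then none of the x_i ([exists_new_apex]).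

    With n + 1 apexes the heights f_i are the barycentric coordinates of the
    x_i, so that every y satisfies y = sum_i f_i (y) x_i and
    sum_i f_i (y) = 1 ([dual_barycentric]).  All f_i are nonnegative on K, hence
    K is contained in the hull of the x_i; the other inclusion is the convexity
    of K. *)

Set Implicit Arguments.
Unset Strict Implicit.

(** * The Euclidean pairing and dense sets *)

Lemma dotDr (R : realType) (n : nat) (u v w : 'rV[R]_n) :
  dot u (v + w) = dot u v + dot u w.
Proof. by rewrite -big_split; apply: eq_bigr => i _; rewrite mxE mulrDr. Qed.

Lemma dotZr (R : realType) (n : nat) (u v : 'rV[R]_n) (t : R) :
  dot u (t *: v) = t * dot u v.
Proof. by rewrite mulr_sumr; apply: eq_bigr => i _; rewrite mxE mulrCA. Qed.

Lemma dotBr (R : realType) (n : nat) (u v w : 'rV[R]_n) :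
  dot u (v - w) = dot u v - dot u w.
Proof. by rewrite -scaleN1r dotDr dotZr mulN1r. Qed.

Lemma dotC (R : realType) (n : nat) (u v : 'rV[R]_n) : dot u v = dot v u.
Proof. by apply: eq_bigr => i _; rewrite mulrC. Qed.

Lemma dot_sumr (R : realType) (n : nat) (I : finType) (u : 'rV[R]_n)
    (F : I -> 'rV[R]_n) : dot u (\sum_i F i) = \sum_i dot u (F i).
Proof.
apply: (big_morph (dot u) (dotDr u)).
by rewrite /dot big1// => i _; rewrite mxE mulr0.
Qed.

Lemma dot_gt0 (R : realType) (n : nat) (v : 'rV[R]_n) : v != 0 -> 0 < dot v v.
Proof.
move=> v0; rewrite lt_neqAle eq_sym sumr_ge0 ?andbT => [|i _]; last first.
  by rewrite -expr2 sqr_ge0.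
apply: contra v0 => /eqP v0; apply/eqP/rowP => i; rewrite mxE; apply/eqP.
rewrite -sqrf_eq0 expr2; apply/eqP; apply: psumr_eq0P v0 i isT => i _.
by rewrite -expr2 sqr_ge0.
Qed.

Lemma continuous_dotl (R : realType) (n : nat) (w : 'rV[R]_n) :
  continuous (fun v : 'rV[R]_n => dot v w).
Proof.
apply: continuous_big => [|i _ v]; first exact: add_continuous.
apply: (@continuousM _ _ (fun u : 'rV[R]_n => u ord0 i) (fun=> w ord0 i)).
  exact: coord_continuous.
exact: cst_continuous.
Qed.

Lemma dense_nbhs (T : topologicalType) (G P : set T) (v : T) :
  dense G -> nbhs v P -> exists2 g, G g & P g.
Proof.
move=> dG vP; have [|g [Pg Gg]] := dG _ _ (open_interior P).
  by exists v.
by exists g => //; exact: interior_subset Pg.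
Qed.

(** * Convex combinations *)

(** The weights 0 and 1 are left out because strict convexity arguments, such as
    the one for [convex_top_face], only work with positive weights. *)
Lemma convex_setP (R : realType) (n : nat) (C : set 'rV[R]_n) :
  convex_set C <-> forall (x y : 'rV[R]_n) (s t : R),
    0 < s -> 0 < t -> s + t = 1 -> C x -> C y -> C (s *: x + t *: y).
Proof.
split=> [cC x y s t s0 t0 st Cx Cy|cC].
  have s1 : s <= 1 by rewrite -st lerDl ltW.
  have := cC x y (Itv01 (ltW s0) s1); rewrite !inE => /(_ Cx Cy).
  by rewrite /conv/= /unstable.onem -[X in X - s]st addrAC subrr add0r.
apply/convex_setW => x y; rewrite !inE => Cx Cy k k0 k1; rewrite inE.
by apply: cC => //; rewrite /unstable.onem ?subr_gt0// addrC subrK.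
Qed.

Lemma convex_sum (R : realType) (n : nat) (C : set 'rV[R]_n) (k : nat)
    (w : 'I_k -> R) (x : 'I_k -> 'rV[R]_n) :
  convex_set C -> (forall i, 0 <= w i) -> \sum_i w i = 1 ->
  (forall i, C (x i)) -> C (\sum_i w i *: x i).
Proof.
move=> cC; elim: k w x => [|k IH] w x w0.
  by rewrite big_ord0 => /esym/eqP; rewrite oner_eq0.
rewrite !big_ord_recl => w1 Cx; set s := w ord0 in w1 *.
set W := \sum_(i < k) _ in w1.
have W0 : 0 <= W by apply: sumr_ge0.
(* Induct on the normalized combination of the tail; it exists unless the tail
   has total weight 0. *)
have [W0'|Wn0] := eqVneq W 0.
  rewrite big1 => [|i _]; first by rewrite addr0 -[s]addr0 -W0' w1 scale1r.
  by rewrite (psumr_eq0P (fun i _ => w0 (lift ord0 i)) W0') ?scale0r.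
have Wp : 0 < W by rewrite lt_neqAle eq_sym Wn0.
have CW : C (\sum_(i < k) (W^-1 * w (lift ord0 i)) *: x (lift ord0 i)).
  apply: IH => //; first by move=> i; rewrite mulr_ge0 ?invr_ge0.
  by rewrite -mulr_sumr mulVf.
have -> : \sum_(i < k) w (lift ord0 i) *: x (lift ord0 i) =
    W *: \sum_(i < k) (W^-1 * w (lift ord0 i)) *: x (lift ord0 i).
  by rewrite scaler_sumr; apply: eq_bigr => i _; rewrite scalerA mulVKf.
have [s0|sn0] := eqVneq s 0.
  by move: w1 CW; rewrite s0 add0r => ->; rewrite scale0r add0r scale1r.
by apply: (iffLR (convex_setP C) cC) => //; rewrite lt_neqAle eq_sym sn0 w0.
Qed.

(** * Apexes and their heights *)

Definition height (R : realType) (n : nat) (a : 'rV[R]_n) (b : R)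
    (x : 'rV[R]_n) : R := dot a x - b.

Lemma height_conv (R : realType) (n : nat) (a : 'rV[R]_n) (b : R)
    (x y : 'rV[R]_n) (s t : R) : s + t = 1 ->
  height a b (s *: x + t *: y) = s * height a b x + t * height a b y.
Proof. by move=> /(canRL (addKr _)) ->; rewrite /height dotDr !dotZr; ring. Qed.

(** The last clause says that K lies in the convex hull of p and of its own section
    at height 0.  It is the induction principle from which all consequences are
    drawn: a convex condition holding at p and on the section holds on K. *)
Definition apex (R : realType) (n : nat) (K : set 'rV[R]_n) (p a : 'rV[R]_n)
    (b : R) : Prop :=
  [/\ K p, height a b p = 1 & forall C : set 'rV[R]_n,
    convex_set C -> C p -> K `&` [set x | height a b x = 0] `<=` C -> K `<=` C].

Lemma apex_of_cone (R : realType) (n : nat) (K H B : set 'rV[R]_n)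
    (p : 'rV[R]_n) :
  affine_hyperplane H -> ~ H p -> B `<=` H ->
  K = conv_hull ([set p] `|` B) -> exists a b, apex K p a b.
Proof.
move=> [a [b [_ ->]]] /= Hp BH KE.
have s0 : dot a p - b != 0 by rewrite subr_eq0; apply/eqP.
set s := dot a p - b in s0.
have hE y : height (s^-1 *: a) (b / s) y = s^-1 * (dot a y - b).
  by rewrite /height dotC dotZr dotC; ring.
have subK : [set p] `|` B `<=` K by rewrite KE; exact: sub_gen_smallest.
exists (s^-1 *: a), (b / s); split.
- by apply: subK; left.
- by rewrite hE mulVf.
- move=> C cC Cp CB; rewrite KE; apply: smallest_sub => // x [->//|Bx].
  apply: CB; split; first by apply: subK; right.
  by rewrite /= hE (BH _ Bx) subrr mulr0.
Qed.

Lemma apex_height_ge0 (R : realType) (n : nat) (K : set 'rV[R]_n)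
    (p a : 'rV[R]_n) (b : R) (x : 'rV[R]_n) :
  apex K p a b -> K x -> 0 <= height a b x.
Proof.
move=> [_ hp KC] Kx; apply: (KC [set y | 0 <= height a b y]) Kx => {x} /=; last 2 first.
- by rewrite hp ler01.
- by move=> x [_ /= ->].
apply/convex_setP => x y s t s0 t0 st /= hx hy.
by rewrite height_conv// addr_ge0// mulr_ge0// ltW.
Qed.

(** If a proper convex combination of points of height at most 1 has height 1,
    then both points have height 1: the top face is extreme, so a convex
    condition may be imposed on it alone without losing convexity. *)
Lemma convex_top_face (R : realType) (n : nat) (D : set 'rV[R]_n)
    (a : 'rV[R]_n) (b : R) : convex_set D ->
  convex_set [set x | height a b x <= 1 /\ (height a b x = 1 -> D x)].
Proof.
move=> /convex_setP cD; apply/convex_setP => x y s t s0 t0 st /= [x1 Dx] [y1 Dy].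
rewrite height_conv//; split; first by nra.
move=> h1; apply: cD => //; [apply: Dx|apply: Dy]; nra.
Qed.

Lemma apex_top_face (R : realType) (n : nat) (K D : set 'rV[R]_n)
    (p a : 'rV[R]_n) (b : R) (x : 'rV[R]_n) :
  apex K p a b -> convex_set D -> D p -> K x ->
  height a b x <= 1 /\ (height a b x = 1 -> D x).
Proof.
move=> [_ hp KC] cD Dp Kx.
suff KF : K `<=` [set y | height a b y <= 1 /\ (height a b y = 1 -> D y)].
  exact: KF.
apply: KC => [||y] /=; [exact: convex_top_face|by rewrite hp|].
by move=> [_ /= ->]; split; [exact: ler01|move/eqP; rewrite eq_sym oner_eq0].
Qed.

Lemma convex_set1 (R : realType) (n : nat) (p : 'rV[R]_n) : convex_set [set p].
Proof. by apply/convex_setP => x y s t _ _ st -> ->; rewrite -scalerDl st scale1r. Qed.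

(** The top face of the cone is its apex alone, so every apex is exposed. *)
Lemma apex_height_lt1 (R : realType) (n : nat) (K : set 'rV[R]_n)
    (p a : 'rV[R]_n) (b : R) (x : 'rV[R]_n) :
  apex K p a b -> K x -> x <> p -> height a b x < 1.
Proof.
move=> Kp Kx xp.
have [h1 hx] := apex_top_face Kp (@convex_set1 R n p) erefl Kx.
by rewrite lt_neqAle h1 andbT; apply/eqP => /hx.
Qed.

(** As q is extreme, it lies either at p or in the base of the cone with apex p.
    Formally, the condition that a point of top height for q has height 0 for p
    is convex, holds on the base of p for trivial reasons, and holds at p because
    p is below the top height for q. *)
Lemma apex_height_eq0 (R : realType) (n : nat) (K : set 'rV[R]_n)
    (p a q c : 'rV[R]_n) (b d : R) :
  apex K p a b -> apex K q c d -> p <> q -> height a b q = 0.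
Proof.
move=> Kp Kq pq.
have [Kpp hp KC] := Kp; have [Kqq hq _] := Kq.
have cD : convex_set [set x | height a b x = 0].
  apply/convex_setP => x y s t _ _ st /= hx hy.
  by rewrite height_conv// hx hy !mulr0 addr0.
suff KF : K `<=` [set y | height c d y <= 1 /\
    (height c d y = 1 -> height a b y = 0)] by case: (KF q Kqq) => _; exact.
apply: KC => [||x [Kx hx]] /=; first exact: convex_top_face.
  have := apex_height_lt1 Kq Kpp pq.
  by move=> h1; split=> [|h]; [exact: ltW|rewrite h ltxx in h1].
split=> //; have [->|/eqP xq] := eqVneq x q; first by rewrite hq.
by apply/ltW/(apex_height_lt1 Kq).
Qed.

(** * Barycentric coordinates from a dual system *)

(** The linear parts of the dual functions form a right inverse of the matrix of
    edges from x_0, which is the affine independence of the x_i. *)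
Lemma dual_edge_mulmx (R : realType) (n k : nat)
    (x a : 'I_k.+1 -> 'rV[R]_n) (b : 'I_k.+1 -> R) :
  (forall i j, height (a i) (b i) (x j) = (i == j)%:R) ->
  (\matrix_(i < k) (x (lift ord0 i) - x ord0)) *m
    (\matrix_(j < k) a (lift ord0 j))^T = 1%:M.
Proof.
move=> hx; apply/matrixP => i j; rewrite !mxE.
have -> : (i == j)%:R = dot (a (lift ord0 j)) (x (lift ord0 i) - x ord0).
  rewrite dotBr.
  have := hx (lift ord0 j) (lift ord0 i); have := hx (lift ord0 j) ord0.
  rewrite (inj_eq lift_inj) eq_sym (eq_sym j) /height => /= h0 h1.
  by rewrite -h1; move: h0 => /=; rewrite mulr0n; lra.
by apply: eq_bigr => l _; rewrite !mxE mulrC.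
Qed.

(** For n + 1 points the edge matrix is square, so its right inverse is also a
    left inverse: the linear parts of the dual functions give the coordinates of
    y - x_0 in the basis of edges.  The coefficient of x_0 is then read off by
    applying the dual function at x_0. *)
Lemma dual_barycentric (R : realType) (n : nat)
    (x a : 'I_n.+1 -> 'rV[R]_n) (b : 'I_n.+1 -> R) (y : 'rV[R]_n) :
  (forall i j, height (a i) (b i) (x j) = (i == j)%:R) ->
  \sum_i height (a i) (b i) y = 1 /\
  y = \sum_i height (a i) (b i) y *: x i.
Proof.
move=> hx; have /mulmx1C AM := dual_edge_mulmx hx.
(* The functions of positive index vanish at x_0, so their values at y are those
   of their linear parts at y - x_0. *)
have yE : y = x ord0 + \sum_(j < n) height (a (lift ord0 j)) (b (lift ord0 j)) y
    *: (x (lift ord0 j) - x ord0).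
  rewrite -[LHS](subrK (x ord0)) addrC; congr (_ + _).
  rewrite -[LHS]mulmx1 -AM mulmxA mulmx_sum_row; apply: eq_bigr => j _.
  rewrite rowK; congr (_ *: _).
  have := hx (lift ord0 j) ord0; rewrite /= mulr0n => h0.
  rewrite -[RHS]subr0 -h0 /height opprB addrA subrK -dotBr mxE.
  by apply: eq_bigr => l _; rewrite !mxE mulrC.
have s1 : height (a ord0) (b ord0) y =
    1 - \sum_(j < n) height (a (lift ord0 j)) (b (lift ord0 j)) y.
  rewrite [in LHS]yE /height dotDr dot_sumr addrAC.
  rewrite -[X in X + _]/(height (a ord0) (b ord0) (x ord0)) hx eqxx; congr (_ + _).
  rewrite -sumrN; apply: eq_bigr => j _; rewrite dotZr dotBr.
  have := hx ord0 ord0; have := hx ord0 (lift ord0 j).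
  rewrite eqxx /height /= mulr0n => h0 h1.
  have -> : dot (a ord0) (x (lift ord0 j)) - dot (a ord0) (x ord0) = -1 by lra.
  by rewrite mulrN1.
rewrite !big_ord_recl s1 subrK; split=> //.
rewrite [LHS]yE scalerBl scale1r scaler_suml -addrA; congr (_ + _).
rewrite addrC -sumrB; apply: eq_bigr => j _.
by rewrite scalerBr.
Qed.

(** * Producing n + 1 apexes *)

(** The fewer than n edges from x_0 have a common nonzero normal v.  The linear
    form of v is constant on the x_i, whereas it is neither minimal nor maximal
    over K at an interior point of K. *)
Lemma separating_direction (R : realType) (n k : nat) (K : set 'rV[R]_n)
    (x : 'I_k.+1 -> 'rV[R]_n) :
  (k < n)%N -> K° !=set0 ->
  exists v y, K y /\ forall i, dot v y < dot v (x i).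
Proof.
move=> kn [z zK].
pose M := \matrix_(i < k) (x (lift ord0 i) - x ord0).
have /rowV0Pn[v /sub_kermxP vM v0] : kermx M^T != 0.
  rewrite -mxrank_eq0 mxrank_ker mxrank_tr -lt0n subn_gt0.
  exact: leq_ltn_trans (rank_leq_row M) kn.
have vx i : dot v (x i) = dot v (x ord0).
  case: (unliftP ord0 i) => [j ->|->//]; apply/eqP; rewrite -subr_eq0 -dotBr.
  have /matrixP/(_ ord0 j) := vM; rewrite !mxE => <-; apply/eqP.
  by apply: eq_bigr => l _; rewrite !mxE.
have small : \forall t \near (0 : R), K (z + t *: v).
  have ct : continuous (fun t : R => z + t *: v).
    move=> t; apply: cvgD; first exact: cvg_cst.
    exact: scalel_continuous.
  by apply: (ct 0); rewrite scale0r addr0.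
have [t t0 [Kt KNt]] : exists2 t : R, 0 < t & K (z + t *: v) /\ K (z - t *: v).
  have /nbhs_ballP[e e0 eK] := small.
  have e2 : 0 < e / 2 by rewrite divr_gt0.
  have ee : `|e / 2| < e by rewrite gtr0_norm//; lra.
  exists (e / 2) => //; split; first by apply: eK; rewrite /ball/= sub0r normrN.
  by rewrite -scaleNr; apply: eK; rewrite /ball/= sub0r opprK.
have vv := dot_gt0 v0.
have dotN (w : 'rV[R]_n) : dot (- v) w = - dot v w.
  by rewrite dotC -scaleN1r dotZr mulN1r dotC.
(* Moving from z by -t v or t v, the form of v or of -v drops by t |v|^2; at
   least one of these moves ends strictly below the common value at the x_i. *)
have [h|h] := ltP (dot v z) (dot v (x ord0) + t * dot v v).
  exists v, (z - t *: v); split=> // i; rewrite vx dotBr dotZr; lra.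
exists (- v), (z + t *: v); split=> // i.
by rewrite !dotN vx dotDr dotZr ltrN2; nra.
Qed.

(** The strict inequalities of [separating_direction] define an open set of
    directions, which meets G; for a direction in it no x_i is a minimizer. *)
Lemma exists_new_apex (R : realType) (n k : nat) (K G : set 'rV[R]_n)
    (x : 'I_k.+1 -> 'rV[R]_n) :
  (k < n)%N -> K° !=set0 -> dense G ->
  (forall v, G v -> exists p a b,
     apex K p a b /\ forall y, K y -> dot v p <= dot v y) ->
  exists p a b, apex K p a b /\ forall i, p <> x i.
Proof.
move=> kn K0 dG KG.
have [v [y [Ky vy]]] := separating_direction x kn K0.
have nbhs_vy i : nbhs v [set u | dot u y < dot u (x i)].
  have c : continuous (fun u : 'rV[R]_n => dot u (x i - y)) := @continuous_dotl R n _.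
  have := cvgr_gt _ (c v) 0; rewrite dotBr subr_gt0 => /(_ _ (vy i)).
  by apply: filterS => u; rewrite dotBr subr_gt0.
have := filter_forall (nbhs_filter v) nbhs_vy.
move=> /(dense_nbhs dG)[u /KG[p [a [b [pK pmin]]]] uy].
exists p, a, b; split=> // i pi.
by have := pmin y Ky; rewrite pi leNgt uy.
Qed.

(** Apexes are added one at a time; each new one is distinct from the previous
    ones, so [apex_height_eq0] extends the dual system. *)
Lemma exists_dual_apexes (R : realType) (n : nat) (K G : set 'rV[R]_n) (k : nat) :
  (k <= n)%N -> K° !=set0 -> dense G ->
  (forall v, G v -> exists p a b,
     apex K p a b /\ forall y, K y -> dot v p <= dot v y) ->
  exists (x a : 'I_k.+1 -> 'rV[R]_n) (b : 'I_k.+1 -> R),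
    (forall i, apex K (x i) (a i) (b i)) /\
    forall i j, height (a i) (b i) (x j) = (i == j)%:R.
Proof.
move=> kn K0 dG KG; elim: k kn => [_|k IH kn].
  have [v Gv _] := dense_nbhs dG (filterT : nbhs (0 : 'rV[R]_n) setT).
  have [p [a [b [pK _]]]] := KG v Gv.
  exists (fun=> p), (fun=> a), (fun=> b); split=> // i j.
  by rewrite !ord1 eqxx; case: pK.
have [x [a [b [xK hx]]]] := IH (ltnW kn).
have [p [c [d [pK px]]]] := exists_new_apex x kn K0 dG KG.
pose ext T (z : T) (f : 'I_k.+1 -> T) (i : 'I_k.+2) :=
  if unlift ord0 i is Some j then f j else z.
exists (ext _ p x), (ext _ c a), (ext _ d b); split=> i.
  by rewrite /ext; case: unliftP.
move=> j; rewrite /ext.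
case: (unliftP ord0 i) => [i'|] ->; case: (unliftP ord0 j) => [j'|] ->.
- by rewrite hx (inj_eq lift_inj).
- by rewrite (apex_height_eq0 (xK i') pK) // => /esym/px.
- by rewrite (apex_height_eq0 pK (xK j')).
- by rewrite eqxx; case: pK.
Qed.

Unset Implicit Arguments.
Set Strict Implicit.

Theorem theorem6p2 (R : realType) (n : nat) (K G : set 'rV[R]_n)
  (K_body : convex_body K) (K_full : full_dimensional K)
  (G_dense : dense G)
  (K_cone : forall v : 'rV[R]_n, G v ->
    exists (p : 'rV[R]_n) (H B : set 'rV[R]_n),
      [/\ K p, affine_hyperplane H, ~ H p, convex_body B & B `<=` H] /\
      K = conv_hull ([set p] `|` B) /\
      (forall y : 'rV[R]_n, K y -> dot v p <= dot v y)) :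
  is_simplex n K.
Proof.
have K_apex v : G v -> exists p a b,
    apex K p a b /\ forall y, K y -> dot v p <= dot v y.
  move=> /K_cone[p [H [B [[_ aH Hp _ BH] [KE pmin]]]]].
  by have [a [b pK]] := apex_of_cone aH Hp BH KE; exists p, a, b.
have [x [a [b [xK hx]]]] :=
  exists_dual_apexes (leqnn n) K_full G_dense K_apex.
exists x; split.
  apply/row_freeP; eexists; exact: dual_edge_mulmx hx.
apply/seteqP; split=> [y Ky|]; last first.
  by apply: smallest_sub; [case: K_body|move=> _ [i _ <-]; case: (xK i)].
have [h1 yE] := dual_barycentric y hx.
move=> C [cC xC]; rewrite yE; apply: convex_sum => // i.
  exact: apex_height_ge0 (xK i) Ky.
by apply: xC; exists i.
Qed.
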